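(* Let $\gamma$ be a matrix of polynomials in $d$ commuting variables, let $\Omega = G_\gamma \cap \mathbb{M}_1^d$ be a domain in $\mathbb{C}^d$, and let $\psi$ be a holomorphic function on $\Omega$. Assume that $\| \psi \|_{H^\infty (G_\gamma)} = 1$. Suppose $\tau \in \partial \Omega$ satisfies $$\liminf_{ z \to \tau} \frac{1 - |\psi(z)|^2}{1 - \| \gamma(z) \|^2} = \alpha<\infty ,$$ where $z$ ranges over $\Omega$. Then there exists a complex number $\omega$ of modulus $1$ so that for all $z\in\Omega$ $$\frac{| \psi(z) - \omega |^2}{1 - |\psi(z)|^2} \ \leq \ \alpha \left( \frac{\| I - \gamma(\tau)^* \gamma(z) \|^2}{ 1- \| \gamma(z) \|^2}\right).$$
   Context: $\mathbb{M}_n$ is the set of $n\times n$ complex matrices. $G_\gamma$ is the set of all commuting $d$-tuples $x=(x^1,\dots,x^d)$ of matrices (in $\mathbb{M}_n^d$, for any $n\ge1$) with $\|\gamma(x)\|<1$ (operator norm); thus $\Omega=\{z\in\mathbb{C}^d:\|\gamma(z)\|<1\}$. A holomorphic function $\psi$ on $\Omega$ extends to $G_\gamma$ by the Taylor functional calculus (the joint spectrum of each $x\in G_\gamma$ lies in $\Omega$), giving $\psi(x)\in\mathbb{M}_n$ for $x\in G_\gamma\cap\mathbb{M}_n^d$; $\|\psi\|_{H^\infty(G_\gamma)}:=\sup\{\|\psi(x)\|:x\in G_\gamma\}$. *)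

(* Defs.v *)
From mathcomp Require Import all_boot all_order all_algebra.
From mathcomp Require Import complex.
From mathcomp Require Import all_classical all_reals all_analysis.
(* Not imported: the notations of mpoly clash with those of mathcomp-analysis. *)
From mathcomp Require mpoly.

Set Implicit Arguments.
Unset Strict Implicit.
Unset Printing Implicit Defensive.

Import Order.TTheory GRing.Theory Num.Theory.
Import numFieldNormedType.Exports.

Local Open Scope classical_set_scope.
Local Open Scope ring_scope.

(* The modulus as an element of R; the norm `|z| of R[i] is valued in R[i]. *)
Notation cabs := ComplexField.Normc.normc.

Section MatrixNorm.
Context {R : realType}.
Local Notation C := R[i].

Definition l2norm n (v : 'cV[C]_n) : R :=
  Num.sqrt (\sum_(i < n) cabs (v i 0) ^+ 2).

Definition opnorm m n (A : 'M[C]_(m, n)) : R :=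
  sup [set l2norm (A *m v) | v in [set v : 'cV[C]_n | l2norm v <= 1]].

Definition adjmx m n (A : 'M[C]_(m, n)) : 'M[C]_(n, m) :=
  (map_mx Num.conj A)^T.

End MatrixNorm.

Section PolynomialMatrix.
Context {R : realType} {d p q : nat}.
Local Notation C := R[i].
Implicit Types gamma : 'M[mpoly.mpoly d C]_(p, q).

Definition evalpt gamma (z : 'rV[C^o]_d) : 'M[C]_(p, q) :=
  map_mx (mpoly.meval (z 0)) gamma.

(* The matrices of a tuple have size n.+1, which makes them a nonzero ring. *)
Definition evaltuple gamma n (x : 'I_d -> 'M[C]_n.+1) :
    'M[C]_(\sum_(i < p) n.+1, \sum_(j < q) n.+1) :=
  \mxblock_(i < p, j < q) mpoly.mmap (@scalar_mx C n.+1) x (gamma i j).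

Definition Ggamma gamma n : set ('I_d -> 'M[C]_n.+1) :=
  [set x | (forall i j, x i *m x j = x j *m x i) /\
           opnorm (evaltuple gamma x) < 1].

Definition Omega gamma : set 'rV[C^o]_d := [set z | opnorm (evalpt gamma z) < 1].

End PolynomialMatrix.

Section Topology.
Context {R : realType} {d : nat}.
Local Notation C := R[i].

Definition is_domain (U : set 'rV[C^o]_d) := [/\ open U, connected U & U !=set0].

Definition boundary (U : set 'rV[C^o]_d) := closure U `\` interior U.

(* Differentiability is over the field R[i], i.e. complex differentiability. *)
Definition holomorphic_on (U : set 'rV[C^o]_d) (psi : 'rV[C^o]_d -> C) :=
  forall z, U z -> differentiable (psi : 'rV[C^o]_d -> C^o) z.

End Topology.

Section TaylorFunctionalCalculus.
Context {R : realType} {d : nat}.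
Local Notation C := R[i].

Definition partial (a : 'I_d -> nat) (psi : 'rV[C^o]_d -> C) : 'rV[C^o]_d -> C :=
  foldr (fun i f => iter (a i) (fun g => 'D_(delta_mx 0 i) (g : 'rV[C^o]_d -> C^o)) f)
        psi (enum 'I_d).

Variable n : nat.
Implicit Types x : 'I_d -> 'M[C]_n.+1.

(* For a commuting tuple of matrices the Taylor joint spectrum is the finite
   set of joint eigenvalues. *)
Definition joint_spectrum x : set 'rV[C^o]_d :=
  [set l | exists2 v : 'cV[C]_n.+1, v != 0 &
           forall i, x i *m v = l 0 i *: v].

(* The Riesz idempotent of A at a: the projection onto the kernel of
   B = (A - a) ^+ n.+1 along the image of B. MathComp's kermx and proj_mx refer
   to the action on row vectors; since the Riesz idempotent is a polynomial in
   A, the action on column vectors gives the same matrix. *)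
Definition riesz (A : 'M[C]_n.+1) (a : C) : 'M[C]_n.+1 :=
  let B := (A - a%:M) ^+ n.+1 in proj_mx (kermx B) B.

(* The idempotent of the Taylor functional calculus attached to the point l of
   the joint spectrum; its range is the joint generalized eigenspace at l. *)
Definition joint_riesz x (l : 'rV[C^o]_d) : 'M[C]_n.+1 :=
  \prod_(i < d) riesz (x i) (l 0 i).

(* Taylor expansion of psi about l, evaluated at x. On the joint generalized
   eigenspace at l the powers (x i - l i) ^+ k with k > n vanish, so only
   exponents at most n contribute there. *)
Definition taylor_expansion (psi : 'rV[C^o]_d -> C) x (l : 'rV[C^o]_d) :
    'M[C]_n.+1 :=
  \sum_(a : {ffun 'I_d -> 'I_n.+1})
    (partial (fun i => a i : nat) psi l / (\prod_(i < d) (a i)`!)%:R) *: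
    \prod_(i < d) (x i - (l 0 i)%:M) ^+ a i.

(* The matrix psi(x) of the Taylor functional calculus, for a commuting tuple x
   and psi holomorphic near the (finite) joint spectrum of x: on the spectral
   subspace at l, psi is given by its power series at l. *)
Definition taylor_calculus (psi : 'rV[C^o]_d -> C) x : 'M[C]_n.+1 :=
  \sum_(l \in joint_spectrum x) taylor_expansion psi x l *m joint_riesz x l.

End TaylorFunctionalCalculus.

Definition Hinfnorm {R : realType} {d p q : nat}
    (gamma : 'M[mpoly.mpoly d R[i]]_(p, q)) (psi : 'rV[R[i]^o]_d -> R[i]) : \bar R :=
  ereal_sup [set y | exists n (x : 'I_d -> 'M[R[i]]_n.+1),
    Ggamma gamma x /\ y = (opnorm (taylor_calculus psi x))%:E].

(* Main.v *)
Require Import Defs.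
From mathcomp Require Import all_boot all_order all_algebra.
From mathcomp Require Import complex.
From mathcomp Require Import all_classical all_reals all_analysis.
From mathcomp Require Import ring lra.
From mathcomp Require mpoly.
Import Order.TTheory GRing.Theory Num.Theory.
Import numFieldNormedType.Exports.
Local Open Scope classical_set_scope.
Local Open Scope ring_scope.

Set Implicit Arguments.
Unset Strict Implicit.
Unset Printing Implicit Defensive.

(** Why the theorem is true. For two points z, w of Omega, take unit vectors of
    C^2 with inner product c in [0, 1) and the commuting tuple X of 2 x 2
    matrices with these joint eigenvectors and with joint eigenvalues z and w.
    In the eigenbasis, gamma(X) is a contraction as soon as the 2 x 2 block form
    with diagonal blocks I - gamma(z)^* gamma(z), I - gamma(w)^* gamma(w) and
    off-diagonal block c (I - gamma(z)^* gamma(w)) is positive, and this follows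
    from
      c^2 ||I - gamma(z)^* gamma(w)||^2
        < (1 - ||gamma(z)||^2) (1 - ||gamma(w)||^2)
    (angle_tuple_Ggamma). As psi(X) acts on the same eigenvectors by psi(z) and
    psi(w) (taylor_calculus_eigen), the bound ||psi(X)|| <= 1 is positivity of the
    scalar analogue of that form, whose determinant gives
      c^2 |1 - conj(psi(z)) psi(w)|^2 <= (1 - |psi(z)|^2) (1 - |psi(w)|^2).
    Letting c grow to the largest value allowed yields an inequality of
    Schwarz-Pick type between any two points of Omega (schwarz_pick).

    In that inequality let the first point w tend to tau along points where
    (1 - |psi(w)|^2) / (1 - ||gamma(w)||^2) approaches alpha. By compactness of
    the unit disc, psi(w) may be supposed to converge to some omega
    (unit_disc_cluster). Since ||gamma(w)|| tends to ||gamma(tau)|| >= 1 and alpha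
    is finite, |omega| = 1. Dividing the Schwarz-Pick inequality by
    1 - ||gamma(w)||^2 and passing to the limit gives
      |1 - conj(omega) psi(z)|^2 (1 - ||gamma(z)||^2)
        <= alpha (1 - |psi(z)|^2) ||I - gamma(tau)^* gamma(z)||^2,
    and the left modulus is |psi(z) - omega| because |omega| = 1. *)

(* The real and imaginary parts valued in R, not those valued in R[i]. *)
Local Notation Re := complex.Re.
Local Notation Im := complex.Im.

(** * Real inequalities *)

(** Completing the square: p times the form is
    (p a - r b)^2 + (p q - r^2) b^2. *)
Lemma psd_binary_form (R : realFieldType) (p q r a b : R) :
  0 <= p -> 0 <= q -> r ^+ 2 <= p * q ->
  0 <= p * a ^+ 2 + q * b ^+ 2 - 2 * r * a * b.
Proof.
move=> p0 q0 rpq; have [pz|pn0] := eqVneq p 0.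
  have /eqP : r ^+ 2 = 0.
    by apply/eqP; rewrite eq_le sqr_ge0 andbT; rewrite pz mul0r in rpq.
  by rewrite sqrf_eq0 pz => /eqP ->; rewrite !(mul0r, mulr0) subr0 add0r mulr_ge0 ?sqr_ge0.
have pgt0 : 0 < p by rewrite lt0r pn0.
rewrite -(pmulr_rge0 _ pgt0).
have -> : p * (p * a ^+ 2 + q * b ^+ 2 - 2 * r * a * b) =
  (p * a - r * b) ^+ 2 + (p * q - r ^+ 2) * b ^+ 2 by ring.
by rewrite addr_ge0 ?sqr_ge0 // mulr_ge0 ?sqr_ge0 // subr_ge0.
Qed.

(** The determinant condition for the Hermitian form with diagonal a, b and
    off-diagonal entry c times a complex number of squared modulus k; restricting
    the second variable to multiples of the conjugate of that number leaves the
    real form below. The factor k left in it is cancelled. *)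
Lemma binary_form_discr (R : realFieldType) (a b c k : R) :
  0 <= a -> 0 <= b -> 0 <= k ->
  (forall r s, 0 <= a * r ^+ 2 + b * k * s ^+ 2 - 2 * c * k * r * s) ->
  c ^+ 2 * k <= a * b.
Proof.
move=> a0 b0 k0 h; have [->|kn0] := eqVneq k 0; first by rewrite mulr0 mulr_ge0.
have kgt0 : 0 < k by rewrite lt0r kn0.
have [az|an0] := eqVneq a 0.
  (* The form is then affine in r, so it is negative for r large against b s. *)
  have := h (b + 1) c; rewrite az !mul0r add0r => h1.
  have e : b * k * c ^+ 2 - 2 * c * k * (b + 1) * c = - ((c ^+ 2 * k) * (b + 2)) by ring.
  rewrite e oppr_ge0 pmulr_lle0 // in h1; lra.
have agt0 : 0 < a by rewrite lt0r an0.
(* The minimum over r for fixed s = a is attained at r = c k. *)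
have := h (c * k) a.
have -> : a * (c * k) ^+ 2 + b * k * a ^+ 2 - 2 * c * k * (c * k) * a =
  (a * k) * (a * b - c ^+ 2 * k) by ring.
by rewrite pmulr_rge0 ?subr_ge0 // mulr_gt0.
Qed.

Lemma le_of_le_sqr_scale (R : realFieldType) (x y : R) : 0 <= x -> 0 <= y ->
  (forall t, 0 < t < 1 -> t ^+ 2 * x <= y) -> x <= y.
Proof.
move=> x0 y0 h; rewrite leNgt; apply/negP => yx.
have xgt0 : 0 < x by exact: le_lt_trans yx.
have zx : y / x * x = y by rewrite mulfVK // gt_eqF.
have z0 : 0 <= y / x by rewrite divr_ge0.
have z1 : y / x < 1 by rewrite ltr_pdivrMr // mul1r.
move: (y / x) zx z0 z1 => z zx z0 z1.
(* The midpoint t of y / x and 1 has t^2 > y / x. *)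
have t01 : 0 < (1 + z) / 2 < 1 by lra.
have := h _ t01; rewrite -zx ler_pM2r // => h1.
have : 0 < (1 - z) ^+ 2 by rewrite exprn_gt0 // subr_gt0.
by rewrite sqrrB; nra.
Qed.

Lemma le_of_le_add_eps (R : realFieldType) (x y k : R) : 0 <= k ->
  (forall e, 0 < e < 1 -> x <= y + e * k) -> x <= y.
Proof.
move=> k0 h; apply/ler_addgt0Pr => e e0.
have k1 : 0 < e + k + 1 by lra.
pose t := e / (e + k + 1).
have tE : t * (e + k + 1) = e by rewrite mulfVK // gt_eqF.
have t0 : 0 < t by rewrite divr_gt0.
have t1 : t < 1 by rewrite ltr_pdivrMr // mul1r; lra.
have := h t; rewrite t0 t1 => /(_ isT) /le_trans; apply.
rewrite lerD2l -tE; nra.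
Qed.

(** The difference of the two sides is at least P A^2 + Q B^2 - 2 c N A B when k = 1,
    and this form is definite because c^2 N^2 < P Q. A uniform factor k < 1 is
    extracted, and not just positivity, since membership in the domain asks for a
    norm strictly below 1. *)
Lemma form_contraction (R : realFieldType) (P Q N c : R) :
  0 < P -> P <= 1 -> 0 < Q -> 0 <= N -> 0 <= c < 1 -> c ^+ 2 * N ^+ 2 < P * Q ->
  exists2 k, 0 <= k < 1 & forall A B A' B' S T, 0 <= A -> 0 <= B ->
    A' ^+ 2 <= (1 - P) * A ^+ 2 -> B' ^+ 2 <= (1 - Q) * B ^+ 2 ->
    T <= A * B -> - (N * A * B) <= S ->
    A' ^+ 2 + B' ^+ 2 + 2 * c * (T - S) <= k * (A ^+ 2 + B ^+ 2 + 2 * c * T).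
Proof.
move=> P0 P1 Q0 N0 /andP[c0 c1] cPQ.
(* D is a lower bound for the eigenvalues of [[P, - c N], [- c N, Q]]:
   determinant over trace. *)
pose D := (P * Q - c ^+ 2 * N ^+ 2) / (P + Q).
have PQ0 : 0 < P + Q by rewrite addr_gt0.
have D0 : 0 < D by rewrite divr_gt0 // subr_gt0.
have cN0 : 0 <= c ^+ 2 * N ^+ 2 by rewrite mulr_ge0 ?sqr_ge0.
have DE : D * (P + Q) = P * Q - c ^+ 2 * N ^+ 2 by rewrite mulfVK // gt_eqF.
clearbody D.
have DP : D <= P by rewrite -(ler_pM2r PQ0) DE; nra.
have DQ : D <= Q by rewrite -(ler_pM2r PQ0) DE; nra.
(* The factor 2 comes from comparing A^2 + B^2 + 2 c T with A^2 + B^2. *)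
exists (1 - D / 2); first by lra.
move=> A B A' B' S T A0 B0 sqA sqB TAB SAB.
have psd : 0 <= (P - D) * A ^+ 2 + (Q - D) * B ^+ 2 - 2 * (c * N) * A * B.
  apply: psd_binary_form; rewrite ?subr_ge0 // exprMn.
  have -> : (P - D) * (Q - D) = P * Q - D * (P + Q) + D ^+ 2 by ring.
  by rewrite DE opprB addrCA subrr addr0 lerDl sqr_ge0.
have cross : - (2 * (c * N) * A * B) <= 2 * c * S.
  have -> : - (2 * (c * N) * A * B) = 2 * c * - (N * A * B) by ring.
  by rewrite ler_wpM2l // mulr_ge0.
have size_u : A ^+ 2 + B ^+ 2 + 2 * c * T <= 2 * (A ^+ 2 + B ^+ 2).
  have h1 : 2 * c * T <= 2 * c * (A * B) by rewrite ler_wpM2l // mulr_ge0.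
  have h2 : 2 * c * (A * B) <= 2 * (A * B).
    by rewrite ler_wpM2r ?mulr_ge0 //; lra.
  have := sqr_ge0 (A - B); rewrite sqrrB; lra.
have : D / 2 * (A ^+ 2 + B ^+ 2 + 2 * c * T) <= D / 2 * (2 * (A ^+ 2 + B ^+ 2)).
  by rewrite ler_wpM2l // divr_ge0 // ltW.
lra.
Qed.

(** The lower bound for |omega|, with g, h the norms of gamma at w and tau, c the
    modulus of psi(w), o that of omega, r the distance from gamma(w) to
    gamma(tau) and u that from psi(w) to omega. The defect of psi is at most
    (a + e) times that of gamma, which is O(e) since g >= 1 - e. *)
Lemma boundary_modulus_error (R : realFieldType) (g h c o r u a e : R) :
  0 <= g < 1 -> 1 <= h -> h <= g + r -> 0 <= c <= 1 -> c <= o + u ->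
  0 <= a -> 0 < e < 1 -> r < e -> u < e -> 1 - c ^+ 2 <= (a + e) * (1 - g ^+ 2) ->
  1 <= o + e * (2 * a + 3).
Proof.
move=> /andP[g0 g1] h1 hg /andP[c0 c1] co a0 /andP[e0 e1] re ue cg.
have g2 : 1 - g ^+ 2 <= 2 * e.
  have -> : 1 - g ^+ 2 = (1 - g) * (1 + g) by ring.
  apply: (@le_trans _ _ ((1 - g) * 2)); last by lra.
  by rewrite ler_wpM2l; lra.
have : 1 - c ^+ 2 <= (a + e) * (2 * e).
  by apply: le_trans cg _; rewrite ler_wpM2l //; lra.
have c2 : c ^+ 2 <= c by rewrite expr2 ler_piMl.
have e2 : e * e <= e by rewrite ler_piMl // ltW.
have -> : (a + e) * (2 * e) = 2 * a * e + 2 * (e * e) by ring.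
by have -> : e * (2 * a + 3) = 2 * a * e + 3 * e by [ring]; lra.
Qed.

Lemma le_sqr_add (R : realFieldType) (x y e : R) :
  0 <= x -> 0 <= y <= 2 -> 0 < e < 1 -> x <= y + e -> x ^+ 2 <= y ^+ 2 + 5 * e.
Proof.
move=> x0 /andP[y0 y2] /andP[e0 e1] xy.
have h : x ^+ 2 <= (y + e) ^+ 2 by rewrite ler_sqr ?nnegrE //; lra.
apply: le_trans h _.
have -> : (y + e) ^+ 2 = y ^+ 2 + e * (2 * y + e) by ring.
by rewrite lerD2l [leRHS]mulrC ler_wpM2l; lra.
Qed.

(** The passage to the limit, with all errors made explicit. Here y, m, b, r are
    |1 - conj(psi(w)) psi(z)|, ||I - gamma(w)^* gamma(z)||, 1 - |psi(w)|^2 and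
    1 - ||gamma(w)||^2; x and n are the limits of y and m; s and t are the defects
    of gamma and psi at z. Every correction is linear in e because e < 1. *)
Lemma julia_error (R : realFieldType) (x y s t n m b r a e : R) :
  0 <= x -> 0 <= y <= 2 -> 0 <= s -> 0 <= t -> 0 <= n -> 0 <= m -> 0 < r ->
  0 <= a -> 0 < e < 1 -> x <= y + e -> m <= n + e -> b <= (a + e) * r ->
  y ^+ 2 * (r * s) <= b * t * m ^+ 2 ->
  x ^+ 2 * s <= a * t * n ^+ 2 +
    e * (t * (n + 1) ^+ 2 + a * t * (2 * n + 1) + 5 * s).
Proof.
move=> x0 y02 s0 t0 n0 m0 r0 a0 e01 xy mn br pick.
have /andP[e0 e1] := e01.
have ys : y ^+ 2 * s <= (a + e) * t * (n + e) ^+ 2.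
  rewrite -(ler_pM2r r0) mulrAC -(mulrA (y ^+ 2)); apply: le_trans pick _.
  apply: (@le_trans _ _ ((a + e) * r * t * m ^+ 2)).
    by rewrite ler_wpM2r ?sqr_ge0 // ler_wpM2r.
  have -> : (a + e) * t * (n + e) ^+ 2 * r = (a + e) * r * t * (n + e) ^+ 2.
    by ring.
  rewrite ler_wpM2l ?mulr_ge0 ?addr_ge0 ?(ltW e0) ?(ltW r0) //.
  by rewrite ler_sqr ?nnegrE ?addr_ge0 // ltW.
have xs : x ^+ 2 * s <= y ^+ 2 * s + 5 * e * s.
  by rewrite -mulrDl ler_wpM2r //; exact: le_sqr_add.
have ne1 : (n + e) ^+ 2 <= n ^+ 2 + e * (2 * n + 1).
  have -> : (n + e) ^+ 2 = n ^+ 2 + e * (2 * n + e) by ring.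
  by rewrite lerD2l ler_pM2l //; lra.
have ne2 : (n + e) ^+ 2 <= (n + 1) ^+ 2.
  by rewrite ler_sqr ?nnegrE; lra.
have t1 : a * t * (n + e) ^+ 2 <= a * t * (n ^+ 2 + e * (2 * n + 1)).
  by rewrite ler_wpM2l // mulr_ge0.
have t2 : e * t * (n + e) ^+ 2 <= e * t * (n + 1) ^+ 2.
  by rewrite ler_wpM2l // mulr_ge0 // ltW.
lra.
Qed.

(** * The Euclidean and operator norms *)

Section ComplexNumbers.
Context {R : realType}.
Local Notation C := R[i].
Implicit Types x y : C.

Lemma ReD x y : Re (x + y) = Re x + Re y.
Proof. by case: x => a b; case: y => c e. Qed.

Lemma ImD x y : Im (x + y) = Im x + Im y.
Proof. by case: x => a b; case: y => c e. Qed.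

Lemma ReN x : Re (- x) = - Re x. Proof. by case: x. Qed.

Lemma ImN x : Im (- x) = - Im x. Proof. by case: x. Qed.

Lemma ReM x y : Re (x * y) = Re x * Re y - Im x * Im y.
Proof. by case: x => a b; case: y => c e. Qed.

Lemma ImM x y : Im (x * y) = Re x * Im y + Im x * Re y.
Proof. by case: x => a b; case: y => c e. Qed.

Lemma Re_conj x : Re (Num.conj x) = Re x. Proof. by case: x. Qed.

Lemma Im_conj x : Im (Num.conj x) = - Im x. Proof. by case: x. Qed.

Lemma Re_sum (I : Type) (r : seq I) (P : pred I) (F : I -> C) :
  Re (\sum_(i <- r | P i) F i) = \sum_(i <- r | P i) Re (F i).
Proof. exact: (big_morph _ ReD). Qed.

Lemma cabs_sqr x : cabs x ^+ 2 = Re x ^+ 2 + Im x ^+ 2.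
Proof. by case: x => a b /=; rewrite sqr_sqrtr // addr_ge0 ?sqr_ge0. Qed.

Lemma cabs_ge0 x : 0 <= cabs x.
Proof. by case: x => a b; exact: sqrtr_ge0. Qed.

Lemma cabs_norm x : `|x| = (cabs x)%:C%C.
Proof. by case: x. Qed.

Lemma cabsD x y : cabs (x + y) <= cabs x + cabs y.
Proof. exact: le_normcD. Qed.

Lemma cabsM x y : cabs (x * y) = cabs x * cabs y.
Proof. exact: ComplexField.Normc.normcM. Qed.

Lemma cabs_conj x : cabs (Num.conj x) = cabs x.
Proof. by case: x => a b /=; rewrite sqrrN. Qed.

Lemma cabsN x : cabs (- x) = cabs x.
Proof. exact: normcN. Qed.

Lemma cabs1 : cabs (1 : C) = 1.
Proof. exact: ComplexField.Normc.normc1. Qed.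

Lemma cabs0 : cabs (0 : C) = 0.
Proof. exact: ComplexField.Normc.normc0. Qed.

Lemma cabs_real (a : R) : cabs a%:C%C = `|a|.
Proof. by rewrite /= expr0n addr0 sqrtr_sqr. Qed.

Definition re_im := (ReD, ReN, ReM, Re_conj, ImD, ImN, ImM, Im_conj).

End ComplexNumbers.

Section InnerProduct.
Context {R : realType}.
Local Notation C := R[i].

Lemma adjmxM m n k (A : 'M[C]_(m, n)) (B : 'M[C]_(n, k)) :
  adjmx (A *m B) = adjmx B *m adjmx A.
Proof. by rewrite /adjmx map_mxM trmx_mul. Qed.

Lemma adjmxD m n (A B : 'M[C]_(m, n)) : adjmx (A + B) = adjmx A + adjmx B.
Proof. by rewrite /adjmx map_mxD linearD. Qed.

Lemma adjmxB m n (A B : 'M[C]_(m, n)) : adjmx (A - B) = adjmx A - adjmx B.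
Proof. by rewrite /adjmx map_mxB linearB. Qed.

Lemma adjmxK m n (A : 'M[C]_(m, n)) : adjmx (adjmx A) = A.
Proof. by apply/matrixP => i j; rewrite !mxE conjCK. Qed.

(** The real part of the Hermitian product: it polarizes the norm and keeps every
    estimate among real numbers. *)
Definition rdot n (u v : 'cV[C]_n) : R := Re ((adjmx u *m v) 0 0).

Lemma rdotE n (u v : 'cV[C]_n) :
  rdot u v = \sum_i (Re (u i 0) * Re (v i 0) + Im (u i 0) * Im (v i 0)).
Proof.
rewrite /rdot mxE Re_sum; apply: eq_bigr => i _.
by rewrite !mxE !re_im /=; ring.
Qed.

Lemma rdotC n (u v : 'cV[C]_n) : rdot u v = rdot v u.
Proof. by rewrite !rdotE; apply: eq_bigr => i _; ring. Qed.

Lemma rdotDl n (u v w : 'cV[C]_n) : rdot (u + v) w = rdot u w + rdot v w.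
Proof. by rewrite /rdot adjmxD mulmxDl mxE ReD. Qed.

Lemma rdotDr n (u v w : 'cV[C]_n) : rdot w (u + v) = rdot w u + rdot w v.
Proof. by rewrite ![rdot w _]rdotC rdotDl. Qed.

Lemma rdotBr n (u v w : 'cV[C]_n) : rdot w (u - v) = rdot w u - rdot w v.
Proof. by rewrite /rdot mulmxBr [X in Re X]mxE [X in _ + X]mxE re_im ReN. Qed.

Lemma rdotZl n (c : R) (u v : 'cV[C]_n) : rdot (c%:C%C *: u) v = c * rdot u v.
Proof.
rewrite !rdotE big_distrr; apply: eq_bigr => i _.
by rewrite !mxE !re_im /=; ring.
Qed.

Lemma rdotZr n (c : R) (u v : 'cV[C]_n) : rdot u (c%:C%C *: v) = c * rdot u v.
Proof. by rewrite rdotC rdotZl rdotC. Qed.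

Lemma rdot_adj m n (A : 'M[C]_(m, n)) (u : 'cV[C]_m) (v : 'cV[C]_n) :
  rdot u (A *m v) = rdot (adjmx A *m u) v.
Proof. by rewrite /rdot adjmxM adjmxK mulmxA. Qed.

Lemma l2norm_ge0 n (v : 'cV[C]_n) : 0 <= l2norm v.
Proof. exact: sqrtr_ge0. Qed.

Lemma l2norm_sqr n (v : 'cV[C]_n) : l2norm v ^+ 2 = rdot v v.
Proof.
rewrite sqr_sqrtr; last by apply: sumr_ge0 => i _; exact: sqr_ge0.
by rewrite rdotE; apply: eq_bigr => i _; rewrite cabs_sqr -!expr2.
Qed.

Lemma rdot_ge0 n (v : 'cV[C]_n) : 0 <= rdot v v.
Proof. by rewrite -l2norm_sqr sqr_ge0. Qed.

Lemma l2norm0_eq0 n (v : 'cV[C]_n) : l2norm v = 0 -> v = 0.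
Proof.
move=> v0; have /eqP : rdot v v = 0 by rewrite -l2norm_sqr v0 expr0n.
rewrite rdotE psumr_eq0 => [/allP h|i _]; last by rewrite addr_ge0 // -expr2 sqr_ge0.
apply/matrixP => i j; rewrite ord1 mxE; apply/eqP.
have := h i (mem_index_enum i); rewrite -!expr2 paddr_eq0 ?sqr_ge0 // !sqrf_eq0.
by rewrite eq_complex.
Qed.

Lemma l2norm0 n : l2norm (0 : 'cV[C]_n) = 0.
Proof.
apply/eqP; rewrite -sqrf_eq0 l2norm_sqr rdotE big1 // => i _.
by rewrite !mxE !mul0r addr0.
Qed.

Lemma l2normZ n (c : C) (v : 'cV[C]_n) : l2norm (c *: v) = cabs c * l2norm v.
Proof.
apply/eqP; rewrite -(@eqrXn2 _ 2) ?mulr_ge0 ?l2norm_ge0 ?cabs_ge0 // exprMn cabs_sqr.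
rewrite !l2norm_sqr !rdotE big_distrr; apply/eqP/eq_bigr => i _.
by rewrite !mxE !re_im /=; ring.
Qed.

Lemma rdot_le n (u v : 'cV[C]_n) : rdot u v <= l2norm u * l2norm v.
Proof.
set a := l2norm u; set b := l2norm v.
have [a0|a0] := eqVneq a 0.
  by rewrite (l2norm0_eq0 a0) a0 mul0r rdotE big1 // => i _; rewrite !mxE !mul0r addr0.
have [b0|b0] := eqVneq b 0.
  by rewrite (l2norm0_eq0 b0) b0 mulr0 rdotE big1 // => i _; rewrite !mxE !mulr0 addr0.
have ab : 0 < a * b by rewrite mulr_gt0 // lt0r ?a0 ?b0 l2norm_ge0.
(* The square of the norm of b u - a v is 2 a b (a b - <u, v>). *)
have := rdot_ge0 (b%:C%C *: u + (- a)%:C%C *: v).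
rewrite !rdotDl !rdotDr !rdotZl !rdotZr -!l2norm_sqr -/a -/b (rdotC v u) => h.
rewrite -subr_ge0 -(pmulr_rge0 _ ab); nra.
Qed.

Lemma rdot_norm_le n (u v : 'cV[C]_n) : `|rdot u v| <= l2norm u * l2norm v.
Proof.
rewrite ler_norml rdot_le andbT lerNl.
have -> : - rdot u v = rdot ((-1)%:C%C *: u) v by rewrite rdotZl mulN1r.
apply: (le_trans (rdot_le _ _)); rewrite l2normZ cabs_real.
by rewrite normrN normr1 mul1r.
Qed.

Lemma l2normD n (u v : 'cV[C]_n) : l2norm (u + v) <= l2norm u + l2norm v.
Proof.
rewrite -ler_sqr ?nnegrE ?addr_ge0 ?l2norm_ge0 // l2norm_sqr.
rewrite rdotDl !rdotDr (rdotC v u) -!l2norm_sqr.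
have := rdot_le u v; nra.
Qed.

Lemma l2norm_sum n (I : Type) (r : seq I) (F : I -> 'cV[C]_n) :
  l2norm (\sum_(i <- r) F i) <= \sum_(i <- r) l2norm (F i).
Proof.
elim/big_ind2: _ => [|u a v b ua vb|//]; first by rewrite l2norm0.
exact: le_trans (l2normD _ _) (lerD ua vb).
Qed.

Lemma l2norm_delta n (i : 'I_n) : l2norm (delta_mx i 0 : 'cV[C]_n) = 1.
Proof.
rewrite /l2norm (bigD1 i) //= big1 => [|j /negPf ji].
  by rewrite mxE !eqxx cabs1 expr1n addr0 sqrtr1.
by rewrite mxE ji cabs0 expr0n.
Qed.

Lemma cabs_entry_le n (v : 'cV[C]_n) i : cabs (v i 0) <= l2norm v.
Proof.
rewrite -ler_sqr ?nnegrE ?cabs_ge0 ?l2norm_ge0 //.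
rewrite sqr_sqrtr; last by apply: sumr_ge0 => j _; exact: sqr_ge0.
by rewrite (bigD1 i) //= lerDl sumr_ge0 // => j _; exact: sqr_ge0.
Qed.

End InnerProduct.

Section OperatorNorm.
Context {R : realType}.
Local Notation C := R[i].

(** A crude bound by the entries serves twice: it makes the supremum defining
    opnorm finite, and it turns entrywise continuity into continuity in norm. *)
Lemma mulmx_entries_bound m n (A : 'M[C]_(m, n)) (v : 'cV[C]_n) :
  l2norm (A *m v) <= (\sum_j \sum_i cabs (A i j)) * l2norm v.
Proof.
have -> : A *m v = \sum_j \sum_i (v j 0 * A i j) *: delta_mx i 0.
  apply/matrixP => i k; rewrite ord1 mxE summxE; apply: eq_bigr => j _.
  rewrite summxE (bigD1 i) //= big1 => [|l /negPf li].
    by rewrite !mxE !eqxx mulr1 addr0 mulrC.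
  by rewrite !mxE eq_sym li mulr0.
apply: (le_trans (l2norm_sum _ _)); rewrite mulr_suml; apply: ler_sum => j _.
apply: (le_trans (l2norm_sum _ _)); rewrite mulr_suml; apply: ler_sum => i _.
rewrite l2normZ l2norm_delta mulr1 cabsM mulrC.
by rewrite ler_wpM2l ?cabs_ge0 // cabs_entry_le.
Qed.

Let ball_image m n (A : 'M[C]_(m, n)) :=
  [set l2norm (A *m v) | v in [set v : 'cV[C]_n | l2norm v <= 1]].

Let ball_image_sup m n (A : 'M[C]_(m, n)) : has_sup (ball_image A).
Proof.
split; first by exists (l2norm (A *m 0)), 0 => //=; rewrite l2norm0 ler01.
exists (\sum_j \sum_i cabs (A i j)) => _ [v /= v1 <-].
apply: (le_trans (mulmx_entries_bound _ _)).
by apply: ler_piMr => //; apply: sumr_ge0 => j _; apply: sumr_ge0 => i _; exact: cabs_ge0.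
Qed.

Lemma opnorm_ge0 m n (A : 'M[C]_(m, n)) : 0 <= opnorm A.
Proof.
apply: (le_trans (l2norm_ge0 (A *m 0))); apply: ub_le_sup.
  exact: (ball_image_sup A).2.
by exists 0 => //=; rewrite l2norm0 ler01.
Qed.

Lemma opnorm_mul m n (A : 'M[C]_(m, n)) (v : 'cV[C]_n) :
  l2norm (A *m v) <= opnorm A * l2norm v.
Proof.
have [v0|v0] := eqVneq (l2norm v) 0.
  by rewrite (l2norm0_eq0 v0) mulmx0 !l2norm0 mulr0.
have vgt0 : 0 < l2norm v by rewrite lt0r v0 l2norm_ge0.
set c := (l2norm v)^-1%:C%C.
have cE : cabs c = (l2norm v)^-1.
  by rewrite cabs_real ger0_norm // invr_ge0 l2norm_ge0.
rewrite -ler_pdivrMr // mulrC -cE -l2normZ scalemxAr; apply: ub_le_sup.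
  exact: (ball_image_sup A).2.
by exists (c *: v) => //=; rewrite l2normZ cE mulVf.
Qed.

Lemma opnorm_defect_gt0 m n (A : 'M[C]_(m, n)) :
  opnorm A < 1 -> 0 < 1 - opnorm A ^+ 2.
Proof. by move=> A1; rewrite subr_gt0 expr_lt1 // opnorm_ge0. Qed.

Lemma opnorm_le m n (A : 'M[C]_(m, n)) (k : R) : 0 <= k ->
  (forall v, l2norm (A *m v) <= k * l2norm v) -> opnorm A <= k.
Proof.
move=> k0 h; apply: ge_sup; first exact: (ball_image_sup A).1.
by move=> _ [v /= v1 <-]; apply: (le_trans (h v)); rewrite ler_piMr.
Qed.

Lemma opnorm_entries m n (A : 'M[C]_(m, n)) :
  opnorm A <= \sum_j \sum_i cabs (A i j).
Proof.
apply: opnorm_le (mulmx_entries_bound A).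
by apply: sumr_ge0 => j _; apply: sumr_ge0 => i _; exact: cabs_ge0.
Qed.

Lemma opnormD m n (A B : 'M[C]_(m, n)) : opnorm (A + B) <= opnorm A + opnorm B.
Proof.
apply: opnorm_le => [|v]; first by rewrite addr_ge0 ?opnorm_ge0.
by rewrite mulmxDl mulrDl (le_trans (l2normD _ _)) // lerD ?opnorm_mul.
Qed.

Lemma opnormN m n (A : 'M[C]_(m, n)) : opnorm (- A) = opnorm A.
Proof.
have le B : opnorm (- B : 'M[C]_(m, n)) <= opnorm B.
  apply: opnorm_le => [|v]; first exact: opnorm_ge0.
  by rewrite mulNmx -scaleN1r l2normZ cabsN cabs1 mul1r opnorm_mul.
apply/le_anti/andP; split; first exact: le.
by have := le (- A); rewrite opprK.
Qed.

Lemma opnormM m n k (A : 'M[C]_(m, n)) (B : 'M[C]_(n, k)) :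
  opnorm (A *m B) <= opnorm A * opnorm B.
Proof.
apply: opnorm_le => [|v]; first by rewrite mulr_ge0 ?opnorm_ge0.
rewrite -mulmxA -mulrA (le_trans (opnorm_mul _ _)) //.
by rewrite ler_wpM2l ?opnorm_ge0 // opnorm_mul.
Qed.

(** From ||A^* v||^2 = <v, A A^* v> <= ||v|| ||A|| ||A^* v||. *)
Lemma opnorm_adj_le m n (A : 'M[C]_(m, n)) : opnorm (adjmx A) <= opnorm A.
Proof.
apply: opnorm_le => [|v]; first exact: opnorm_ge0.
set w := adjmx A *m v.
have [->|w0] := eqVneq (l2norm w) 0; first by rewrite mulr_ge0 ?opnorm_ge0 ?l2norm_ge0.
have wgt0 : 0 < l2norm w by rewrite lt0r w0 l2norm_ge0.
rewrite -(ler_pM2r wgt0) -expr2 l2norm_sqr {1}/w -rdot_adj.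
apply: (le_trans (rdot_le _ _)); rewrite -mulrA mulrCA.
by rewrite ler_wpM2l ?l2norm_ge0 // opnorm_mul.
Qed.

Lemma opnorm1_ge1 n : (0 < n)%N -> 1 <= opnorm (1%:M : 'M[C]_n).
Proof.
case: n => // n _; rewrite -{1}(l2norm_delta (@ord0 n)) -[X in l2norm X]mul1mx.
by apply: (le_trans (opnorm_mul _ _)); rewrite l2norm_delta mulr1.
Qed.

Lemma cabs_eigen_le n (A : 'M[C]_n) (v : 'cV[C]_n) (c : C) :
  v != 0 -> A *m v = c *: v -> cabs c <= opnorm A.
Proof.
move=> v0 Av; have vgt0 : 0 < l2norm v.
  by rewrite lt0r l2norm_ge0 andbT; apply: contraNneq v0 => /l2norm0_eq0 ->.
by rewrite -(ler_pM2r vgt0) -l2normZ -Av opnorm_mul.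
Qed.

End OperatorNorm.

(** * The Taylor calculus on diagonalizable tuples *)

Section DiagonalizableTuples.
Context {R : realType}.
Local Notation C := R[i].

Lemma eigen_mul n (A B : 'M[C]_n) (v : 'cV[C]_n) a b :
  A *m v = a *: v -> B *m v = b *: v -> (A *m B) *m v = (a * b) *: v.
Proof.
by move=> Av Bv; rewrite -mulmxA Bv -scalemxAr Av scalerA mulrC.
Qed.

Lemma eigen_exp n (A : 'M[C]_n.+1) (v : 'cV[C]_n.+1) a k :
  A *m v = a *: v -> A ^+ k *m v = a ^+ k *: v.
Proof.
move=> Av; elim: k => [|k IH]; first by rewrite !expr0 mul1mx scale1r.
by rewrite !exprS; exact: eigen_mul.
Qed.

Lemma eigen_prod n (I : Type) (r : seq I) (A : I -> 'M[C]_n.+1) (a : I -> C)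
    (v : 'cV[C]_n.+1) : (forall i, A i *m v = a i *: v) ->
  (\prod_(i <- r) A i) *m v = (\prod_(i <- r) a i) *: v.
Proof.
move=> Av; elim/big_ind2: _ => [|B b D e Bv Dv|//].
  by rewrite mul1mx scale1r.
exact: eigen_mul.
Qed.

Lemma eigen_mmap n d (x : 'I_d -> 'M[C]_n.+1) (l : 'I_d -> C)
    (P : mpoly.mpoly d C) (v : 'cV[C]_n.+1) :
  (forall i, x i *m v = l i *: v) ->
  mpoly.mmap (@scalar_mx C n.+1) x P *m v = mpoly.meval l P *: v.
Proof.
move=> xv; rewrite mpoly.mevalE /mpoly.mmap mulmx_suml scaler_suml.
apply: eq_bigr => m _; apply: eigen_mul; first exact: mul_scalar_mx.
by apply: eigen_prod => i; exact: eigen_exp.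
Qed.

Lemma eigen_subr n (A : 'M[C]_n) (v : 'cV[C]_n) a b :
  A *m v = a *: v -> (A - b%:M) *m v = (a - b) *: v.
Proof. by move=> Av; rewrite mulmxBl Av mul_scalar_mx scalerBl. Qed.

Lemma col_mulmx m n p (A : 'M[C]_(m, n)) (B : 'M[C]_(n, p)) k :
  col k (A *m B) = A *m col k B.
Proof. by rewrite !colE mulmxA. Qed.

Lemma eq_mx_col m n (A B : 'M[C]_(m, n)) :
  (forall k, col k A = col k B) -> A = B.
Proof.
move=> h; apply/matrixP => i j.
by have /matrixP/(_ i 0) := h j; rewrite !mxE.
Qed.

Lemma mulmx_eigen_cols n (A V : 'M[C]_n) (a : 'I_n -> C) :
  (forall k, A *m col k V = a k *: col k V) ->
  A *m V = V *m diag_mx (\row_k a k).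
Proof.
move=> h; apply: eq_mx_col => k; rewrite [LHS]col_mulmx h.
by apply/matrixP => i j; rewrite mul_mx_diag !mxE mulrC.
Qed.

(** The rows of V^-1 are left eigenvectors of A. On each of them B = (A - b)^(n+1)
    acts by a scalar, which vanishes exactly for the eigenvalue b, so these rows
    split into a basis of the row kernel and a basis of the row space of B. The
    projection is therefore diagonal in the rows of V^-1, hence in the columns
    of V. *)
Lemma riesz_eigen n (A V : 'M[C]_n.+1) (a : 'I_n.+1 -> C) (b : C) :
  V \in unitmx -> (forall k, A *m col k V = a k *: col k V) ->
  forall k, riesz A b *m col k V = (a k == b)%:R *: col k V.
Proof.
move=> Vu AV; rewrite /riesz; set B := (A - b%:M) ^+ n.+1; set W := invmx V.
pose e k : C := (a k - b) ^+ n.+1.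
have BV k : B *m col k V = e k *: col k V.
  by apply: eigen_exp; exact: eigen_subr.
have WB k : row k W *m B = e k *: row k W.
  have -> : row k W *m B = row k (diag_mx (\row_k e k) *m W).
    rewrite -row_mul; congr (row k _).
    have BE : B = V *m diag_mx (\row_k e k) *m W.
      by rewrite -(mulmx_eigen_cols BV) (mulmxK Vu).
    by rewrite BE -mulmxA (mulKmx Vu).
  by apply/matrixP => i j; rewrite mxE mul_diag_mx !mxE.
have e0 k : (e k == 0) = (a k == b) by rewrite expf_eq0 /= subr_eq0.
have dxB : (kermx B :&: B = 0)%MS.
  apply/eqP; rewrite -submx0; apply/rV_subP => u; rewrite sub_capmx sub_kermx.
  move=> /andP[/eqP uB /submxP[y uy]]; rewrite submx0.
  (* In the basis W of left eigenvectors, B acts with eigenvalues e, and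
     y B B = 0 forces y B = 0 coordinate by coordinate. *)
  pose c := y *m V.
  have yB z : z *m B = z *m V *m diag_mx (\row_k e k) *m W.
    by rewrite -(mulmxA z V) -(mulmx_eigen_cols BV) mulmxA mulmxK.
  have : u *m B *m V = 0 by rewrite uB mul0mx.
  rewrite yB mulmxKV // uy yB mulmxKV // -/c !mul_mx_diag => /matrixP h.
  suff -> : (\matrix_(i, j) (c i j * (\row_k e k) 0 j)) = 0 by rewrite mul0mx.
  apply/matrixP => i k; have := h i k; rewrite !mxE => /eqP.
  by rewrite mulf_eq0 => /orP[/eqP->//|/eqP->]; rewrite mulr0.
set P := proj_mx _ _.
have WP : W *m P = diag_mx (\row_k (a k == b)%:R) *m W.
  apply/row_matrixP => k; rewrite row_mul.
  have -> : row k (diag_mx (\row_k (a k == b)%:R) *m W) =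
            (a k == b)%:R *: row k W.
    by apply/matrixP => i j; rewrite mxE mul_diag_mx !mxE.
  have [akb|akb] := eqVneq (a k) b.
    rewrite scale1r proj_mx_id // sub_kermx WB.
    by have /eqP -> : e k == 0; rewrite ?scale0r // e0 akb.
  rewrite scale0r proj_mx_0 //; have ek0 : e k != 0 by rewrite e0.
  apply/submxP; exists ((e k)^-1 *: row k W).
  by rewrite -scalemxAl WB scalerA mulVf // scale1r.
have PV : P *m V = V *m diag_mx (\row_k (a k == b)%:R).
  have PE : P = V *m (diag_mx (\row_k (a k == b)%:R) *m W).
    by rewrite -WP (mulKVmx Vu).
  by rewrite PE -mulmxA (mulmxKV Vu).
move=> k; rewrite -col_mulmx PV; apply/matrixP => i j.
by rewrite mxE mul_mx_diag !mxE mulrC.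
Qed.

Lemma partial0 d (psi : 'rV[C^o]_d -> C) : partial (fun=> 0%N) psi = psi.
Proof. by rewrite /partial; elim: (enum _) => //= i r ->. Qed.

(** At a joint eigenvector with eigenvalue l every factor x i - l i vanishes, so
    only the constant term of the Taylor expansion at l survives. *)
Lemma taylor_expansion_eigen n d (psi : 'rV[C^o]_d -> C)
    (x : 'I_d -> 'M[C]_n.+1) (l : 'rV[C^o]_d) (v : 'cV[C]_n.+1) :
  (forall i, x i *m v = l 0 i *: v) ->
  taylor_expansion psi x l *m v = psi l *: v.
Proof.
move=> xv; rewrite /taylor_expansion mulmx_suml.
have term (a : {ffun 'I_d -> 'I_n.+1}) :
    \prod_(i < d) (x i - (l 0 i)%:M) ^+ a i *m v =
    (\prod_(i < d) (0 : C) ^+ a i) *: v.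
  apply: eigen_prod => i; apply: eigen_exp.
  by rewrite (eigen_subr _ (xv i)) subrr.
have term_neq0 (a : {ffun 'I_d -> 'I_n.+1}) : a != [ffun=> ord0] ->
    \prod_(i < d) (x i - (l 0 i)%:M) ^+ a i *m v = 0.
  move=> a0; have [i ai] : exists i, a i != ord0.
    apply/existsP; apply: contraNT a0; rewrite negb_exists => /forallP h.
    by apply/eqP/ffunP => i; rewrite ffunE; have := h i; rewrite negbK => /eqP.
  by rewrite term (bigD1 i) //= expr0n (_ : (a i == 0 :> nat) = false) ?mul0r ?scale0r //; exact: negPf.
rewrite (bigD1 [ffun=> ord0]) //= -[RHS]addr0; congr (_ + _); last first.
  by apply: big1 => a a0; rewrite -scalemxAl term_neq0 // scaler0.
rewrite -scalemxAl term.
have -> : \prod_(i < d) (0 : C) ^+ ([ffun=> ord0] i : 'I_n.+1) = 1.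
  by rewrite big1 // => i _; rewrite ffunE expr0.
have -> : (\prod_(i < d) ([ffun=> ord0] i : 'I_n.+1)`! = 1)%N.
  by rewrite big1 // => i _; rewrite ffunE.
rewrite divr1 scale1r; congr (_ *: _).
by congr (_ l); rewrite -[RHS]partial0; congr partial; apply/funext => i; rewrite ffunE.
Qed.

(** On simultaneously diagonalizable tuples the Taylor calculus applies the function
    to the joint eigenvalues, repeated or not: the idempotent at l selects
    the eigenvectors whose joint eigenvalue is l. *)
Lemma taylor_calculus_eigen n d (psi : 'rV[C^o]_d -> C)
    (x : 'I_d -> 'M[C]_n.+1) (V : 'M[C]_n.+1) (l : 'I_n.+1 -> 'rV[C^o]_d) :
  V \in unitmx -> (forall i k, x i *m col k V = l k 0 i *: col k V) ->
  forall k, taylor_calculus psi x *m col k V = psi (l k) *: col k V.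
Proof.
move=> Vu xV.
have jr m k : joint_riesz x m *m col k V = (l k == m)%:R *: col k V.
  rewrite (eigen_prod _ (a := fun i => (l k 0 i == m 0 i)%:R)); last first.
    by move=> i; apply: (riesz_eigen _ Vu (xV i)).
  congr (_ *: _); have [->|lm] := eqVneq (l k) m.
    by rewrite big1 // => i _; rewrite eqxx.
  have [i li] : exists i, l k 0 i != m 0 i.
    apply/existsP; apply: contraNT lm; rewrite negb_exists => /forallP h.
    by apply/eqP/rowP => i; have := h i; rewrite negbK => /eqP.
  by rewrite (bigD1 i) //= (negPf li) mul0r.
have vn0 k : col k V != 0.
  apply/negP => /eqP vk0; have := congr1 (mulmx (invmx V)) vk0.
  rewrite mulmx0 -col_mulmx mulVmx // => /matrixP/(_ k 0).
  by rewrite !mxE eqxx => /eqP; rewrite oner_eq0.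
have spec k : joint_spectrum x (l k) by exists (col k V).
pose F m := taylor_expansion psi x m *m joint_riesz x m.
have FV m k : F m *m col k V = (l k == m)%:R *: (psi (l k) *: col k V).
  rewrite -[LHS]mulmxA jr -scalemxAr; have [<-|_] := eqVneq (l k) m.
    by rewrite taylor_expansion_eigen.
  by rewrite !scale0r.
rewrite [taylor_calculus psi x](_ : _ = \sum_(m \in joint_spectrum x) F m) //.
clearbody F.
pose r := undup [seq l k | k <- enum 'I_n.+1].
have r_uniq : uniq r by exact: undup_uniq.
have mem_r k : l k \in r by rewrite mem_undup map_f // mem_enum.
move: (joint_spectrum x) spec => S spec.
rewrite (fsbigE _ _ r_uniq).
- move=> k; rewrite mulmx_suml big_mkcond (bigD1_seq (l k)) ?r_uniq //=.
  rewrite (mem_set (spec k)) FV eqxx scale1r.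
  rewrite big1 ?addr0 // => m ml; case: ifP => _ //.
  by rewrite FV eq_sym (negPf ml) scale0r.
- move=> m /=; rewrite mem_undup => /mapP[k _ ->].
  exact: spec.
(* A point of the spectrum outside r contributes nothing, as F m kills every
   column of V. *)
- move=> m _ ml; rewrite -[F m](mulmxK Vu).
  suff -> : F m *m V = 0 by rewrite mul0mx.
  apply: eq_mx_col => k; rewrite col_mulmx FV; case: eqVneq ml => [<-|_ _].
    by rewrite mem_r.
  by rewrite scale0r; apply/matrixP => i j; rewrite !mxE.
Qed.

End DiagonalizableTuples.

(** * Pairs of points as spectra of two-dimensional tuples *)

Section SimultaneousDiagonalization.
Context {R : realType} {d : nat}.
Local Notation C := R[i].

Definition diag_tuple n (V : 'M[C]_n.+1) (l : 'I_n.+1 -> 'rV[C^o]_d) :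
    'I_d -> 'M[C]_n.+1 :=
  fun i => V *m diag_mx (\row_k l k 0 i) *m invmx V.

Lemma diag_tuple_eigen n (V : 'M[C]_n.+1) (l : 'I_n.+1 -> 'rV[C^o]_d) i k :
  V \in unitmx -> diag_tuple V l i *m col k V = l k 0 i *: col k V.
Proof.
move=> Vu; rewrite -col_mulmx /diag_tuple mulmxKV //.
by apply/matrixP => a b; rewrite mxE mul_mx_diag !mxE mulrC.
Qed.

Lemma diag_tuple_comm n (V : 'M[C]_n.+1) (l : 'I_n.+1 -> 'rV[C^o]_d) i j :
  V \in unitmx ->
  diag_tuple V l i *m diag_tuple V l j = diag_tuple V l j *m diag_tuple V l i.
Proof.
move=> Vu; have mul D E : (V *m D *m invmx V) *m (V *m E *m invmx V) =
    V *m (D *m E) *m invmx V.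
  by rewrite mulmxA (mulmxA _ V) (mulmxKV Vu) (mulmxA V).
by rewrite /diag_tuple !mul diag_mxC.
Qed.

Lemma eigen_cols_mul n (A V : 'M[C]_n.+1) (a : 'I_n.+1 -> C) (h : 'cV[C]_n.+1) :
  (forall k, A *m col k V = a k *: col k V) ->
  A *m (V *m h) = V *m \col_k (a k * h k 0).
Proof.
move=> AV; rewrite mulmxA (mulmx_eigen_cols AV) -mulmxA; congr (_ *m _).
by apply/matrixP => i j; rewrite ord1 mul_diag_mx !mxE.
Qed.

(** In the block decomposition of C^q (x) C^(n+1), gamma of a diagonalizable tuple
    acts on the coefficient vectors of the k-th eigenvector by gamma at the k-th
    joint eigenvalue. *)
Lemma evaltuple_diag_tuple p q (gamma : 'M[mpoly.mpoly d C]_(p, q)) n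
    (V : 'M[C]_n.+1) (l : 'I_n.+1 -> 'rV[C^o]_d) (h : 'I_q -> 'cV[C]_n.+1) :
  V \in unitmx ->
  evaltuple gamma (diag_tuple V l) *m \mxcol_j (V *m h j) =
  \mxcol_i (V *m \col_k (evalpt gamma (l k) *m \col_j h j k 0) i 0).
Proof.
move=> Vu; rewrite /evaltuple mul_mxblock_mxrow; apply: eq_mxcol => i.
rewrite (eq_bigr (fun j => V *m \col_k (mpoly.meval (l k 0) (gamma i j) * h j k 0))).
  rewrite -mulmx_sumr; congr (_ *m _); apply/matrixP => k m.
  rewrite summxE !mxE; apply: eq_bigr => j _; by rewrite !mxE.
move=> j _; apply: eigen_cols_mul => k; apply: eigen_mmap => s.
exact: diag_tuple_eigen.
Qed.

Lemma rdot_mxcol n (m : 'I_n -> nat) (u v : forall j, 'cV[C]_(m j)) :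
  rdot (\mxcol_j u j) (\mxcol_j v j) = \sum_j rdot (u j) (v j).
Proof.
rewrite /rdot; have -> : adjmx (\mxcol_j u j) = \mxrow_j adjmx (u j).
  by apply/matrixP => i k; rewrite !mxE.
by rewrite mul_mxrow_mxcol summxE Re_sum.
Qed.

End SimultaneousDiagonalization.

Section TwoPoints.
Context {R : realType} {d : nat}.
Local Notation C := R[i].
Implicit Types (c : R) (z w : 'rV[C^o]_d).

(** The columns are unit vectors with inner product c. A real nonnegative c is
    enough, since only the modulus of the inner product enters the estimates;
    the triangular form makes the determinant the square root of 1 - c^2. *)
Definition angle_basis c : 'M[C]_2 :=
  \matrix_(i, j) (if i == ord0 then if j == ord0 then Num.sqrt (1 - c ^+ 2) else 0
                  else if j == ord0 then c else 1)%:C%C.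

Lemma angle_basis_unit c : 0 <= c < 1 -> angle_basis c \in unitmx.
Proof.
move=> /andP[c0 c1]; rewrite unitmxE det_trig; last first.
  by apply/is_trig_mxP => -[[|[|//]] ?] [[|[|//]] ?] //; rewrite mxE.
rewrite big_ord_recl big_ord1 !mxE /= mulr1 unitfE.
rewrite (inj_eq (@complexI R)) sqrtr_eq0 -ltNge subr_gt0.
by rewrite expr_lt1.
Qed.

Lemma rdot_angle_basis c (h : 'cV[C]_2) : 0 <= c < 1 ->
  rdot (angle_basis c *m h) (angle_basis c *m h) =
  cabs (h 0 0) ^+ 2 + cabs (h 1 0) ^+ 2 +
  2 * c * Re (Num.conj (h 0 0) * h 1 0).
Proof.
move=> /andP[c0 c1].
have s2 : Num.sqrt (1 - c ^+ 2) ^+ 2 = 1 - c ^+ 2.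
  by rewrite sqr_sqrtr // subr_ge0 expr_le1 // ltW.
rewrite rdotE !big_ord_recl !big_ord0 !mxE !big_ord_recl !big_ord0 !mxE /=.
rewrite !re_im !cabs_sqr /=.
have -> : lift ord0 ord0 = 1 :> 'I_2 by exact/val_inj.
have -> : ord0 = 0 :> 'I_2 by exact/val_inj.
move: (Num.sqrt _) s2 => s s2.
transitivity (s ^+ 2 * (Re (h 0 0) ^+ 2 + Im (h 0 0) ^+ 2) +
  ((c * Re (h 0 0) + Re (h 1 0)) ^+ 2 + (c * Im (h 0 0) + Im (h 1 0)) ^+ 2)).
  by ring.
by rewrite s2; ring.
Qed.

Definition pair_fun (T : Type) (a b : T) (k : 'I_2) : T := if k == ord0 then a else b.

Lemma pair_fun0 (T : Type) (a b : T) : pair_fun a b 0 = a. Proof. by []. Qed.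

Lemma pair_fun1 (T : Type) (a b : T) : pair_fun a b 1 = b. Proof. by []. Qed.

(** The Gram matrix of the basis, tensored with the identity of C^q. *)
Lemma rdot_angle_mxcol c q (h : 'I_q -> 'cV[C]_2) : 0 <= c < 1 ->
  let u := \mxcol_j (angle_basis c *m h j) in
  let a := \col_j h j 0 0 in let b := \col_j h j 1 0 in
  rdot u u = l2norm a ^+ 2 + l2norm b ^+ 2 + 2 * c * rdot a b.
Proof.
move=> c01 /=; rewrite rdot_mxcol !l2norm_sqr !rdotE big_distrr -!big_split /=.
apply: eq_bigr => j _; rewrite rdot_angle_basis // !cabs_sqr !mxE !re_im.
by ring.
Qed.

(** With P and Q the defects of G and H, this is form_contraction for
      <G a, H b> = <a, b> - <a, (1 - G^* H) b>. *)
Lemma two_block_contraction p q (G H : 'M[C]_(p, q)) c :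
  let P := 1 - opnorm G ^+ 2 in let Q := 1 - opnorm H ^+ 2 in
  let N := opnorm (1%:M - adjmx G *m H) in
  0 <= c < 1 -> opnorm G < 1 -> opnorm H < 1 -> c ^+ 2 * N ^+ 2 < P * Q ->
  exists2 k, 0 <= k < 1 & forall a b,
    l2norm (G *m a) ^+ 2 + l2norm (H *m b) ^+ 2 + 2 * c * rdot (G *m a) (H *m b)
    <= k * (l2norm a ^+ 2 + l2norm b ^+ 2 + 2 * c * rdot a b).
Proof.
move=> P Q N c01 G1 H1 cPQ.
have P0 : 0 < P := opnorm_defect_gt0 G1.
have Q0 : 0 < Q := opnorm_defect_gt0 H1.
have P1 : P <= 1 by rewrite gerBl sqr_ge0.
have sqM m n (M : 'M[C]_(m, n)) (v : 'cV[C]_n) :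
    l2norm (M *m v) ^+ 2 <= (1 - (1 - opnorm M ^+ 2)) * l2norm v ^+ 2.
  by rewrite subKr -exprMn ler_sqr ?nnegrE ?mulr_ge0 ?opnorm_ge0 ?l2norm_ge0 ?opnorm_mul.
have [k k01 hk] := form_contraction P0 P1 Q0 (opnorm_ge0 _) c01 cPQ.
exists k => // a b.
have -> : rdot (G *m a) (H *m b) = rdot a b - rdot a ((1%:M - adjmx G *m H) *m b).
  by rewrite mulmxBl mul1mx rdotBr subKr -mulmxA [RHS]rdot_adj adjmxK.
apply: hk (l2norm_ge0 a) (l2norm_ge0 b) (sqM _ _ G a) (sqM _ _ H b) (rdot_le a b) _.
have := rdot_norm_le a ((1%:M - adjmx G *m H) *m b).
rewrite ler_norml => /andP[+ _]; apply: le_trans; rewrite lerN2 (mulrC N) -mulrA.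
by rewrite ler_wpM2l ?l2norm_ge0 // opnorm_mul.
Qed.

Lemma angle_tuple_Ggamma p q (gamma : 'M[mpoly.mpoly d C]_(p, q)) z w c :
  0 <= c < 1 -> Omega gamma z -> Omega gamma w ->
  c ^+ 2 * opnorm (1%:M - adjmx (evalpt gamma z) *m evalpt gamma w) ^+ 2 <
  (1 - opnorm (evalpt gamma z) ^+ 2) * (1 - opnorm (evalpt gamma w) ^+ 2) ->
  Ggamma gamma (diag_tuple (angle_basis c) (pair_fun z w)).
Proof.
move=> c01 gz gw cN; have Vu := angle_basis_unit c01.
split; first by move=> i j; exact: diag_tuple_comm.
have [k /andP[k0 k1] hk] := two_block_contraction c01 gz gw cN.
have sk : Num.sqrt k < 1 by rewrite -[X in _ < X]sqrtr1 ltr_sqrt.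
apply: le_lt_trans sk; apply: opnorm_le => [|u]; first exact: sqrtr_ge0.
rewrite -ler_sqr ?nnegrE ?mulr_ge0 ?l2norm_ge0 ?sqrtr_ge0 // exprMn (sqr_sqrtr k0).
pose h j := invmx (angle_basis c) *m submxcol u j.
have uE : u = \mxcol_j (angle_basis c *m h j).
  by rewrite -[LHS]submxcolK; apply: eq_mxcol => j; rewrite mulKVmx.
rewrite !l2norm_sqr uE evaltuple_diag_tuple // !rdot_angle_mxcol //.
set a := \col_j h j 0 0; set b := \col_j h j 1 0.
apply: le_trans (hk a b).
have -> : evalpt gamma z *m a = \col_i (\col_k (evalpt gamma (pair_fun z w k) *m
    \col_j h j k 0) i 0) 0 0.
  by apply/matrixP => i j; rewrite ord1 !mxE.
have -> : evalpt gamma w *m b = \col_i (\col_k (evalpt gamma (pair_fun z w k) *m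
    \col_j h j k 0) i 0) 1 0.
  by apply/matrixP => i j; rewrite ord1 !mxE.
exact: lexx.
Qed.

End TwoPoints.

(** * A Schwarz-Pick inequality *)

(** The Gram form of the eigenbasis at (x, y), minus its value at (a x, b y), has
    cross term 2 c Re (conj(x) y k); the phase of y makes that real. *)
Lemma pick_form_restriction (R : realType) (a b : R[i]) (c r s : R) :
  let k := 1 - Num.conj a * b in
  let x := r%:C%C in let y := - (s%:C%C * Num.conj k) in
  cabs x ^+ 2 + cabs y ^+ 2 + 2 * c * Re (Num.conj x * y) -
  (cabs (a * x) ^+ 2 + cabs (b * y) ^+ 2 +
    2 * c * Re (Num.conj (a * x) * (b * y))) =
  (1 - cabs a ^+ 2) * r ^+ 2 + (1 - cabs b ^+ 2) * cabs k ^+ 2 * s ^+ 2 -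
  2 * c * cabs k ^+ 2 * r * s.
Proof.
case: a => a1 a2; case: b => b1 b2 k x y.
have kR : Re k = 1 - (a1 * b1 + a2 * b2) by rewrite /k !re_im /=; ring.
have kI : Im k = a2 * b1 - a1 * b2 by rewrite /k !re_im /=; ring.
clearbody k; rewrite /x /y !cabs_sqr !re_im /= kR kI.
ring.
Qed.

Section SchwarzPick.
Context {R : realType} {d p q : nat}.
Local Notation C := R[i].
Variables (gamma : 'M[mpoly.mpoly d C]_(p, q)) (psi : 'rV[C^o]_d -> C).
Hypothesis psi_norm : (Hinfnorm gamma psi <= 1%:E)%E.

Let g z := opnorm (evalpt gamma z).
Let N z w := opnorm (1%:M - adjmx (evalpt gamma z) *m evalpt gamma w).

Lemma taylor_calculus_le1 n (x : 'I_d -> 'M[C]_n.+1) :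
  Ggamma gamma x -> opnorm (taylor_calculus psi x) <= 1.
Proof.
move=> gx; rewrite -lee_fin; apply: le_trans psi_norm.
by apply: ereal_sup_ubound; exists n, x.
Qed.

Lemma Omega_defect_gt0 z : Omega gamma z -> 0 < 1 - g z ^+ 2.
Proof. exact: opnorm_defect_gt0. Qed.

Lemma angle_tuple_eigen (c : R) (z w : 'rV[C^o]_d) k : 0 <= c < 1 ->
  taylor_calculus psi (diag_tuple (angle_basis c) (pair_fun z w)) *m
    col k (angle_basis c) = psi (pair_fun z w k) *: col k (angle_basis c).
Proof.
move=> c01; have Vu := angle_basis_unit c01.
by apply: taylor_calculus_eigen => // i j; exact: diag_tuple_eigen.
Qed.

(** psi(z) is an eigenvalue of psi(X) for the diagonal tuple X with both joint
    eigenvalues equal to z. *)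
Lemma cabs_psi_le1 z : Omega gamma z -> cabs (psi z) <= 1.
Proof.
move=> gz; have c01 : 0 <= (0 : R) < 1 by rewrite lexx ltr01.
have gx : Ggamma gamma (diag_tuple (angle_basis 0) (pair_fun z z)).
  apply: angle_tuple_Ggamma => //.
  by rewrite expr0n mul0r mulr_gt0 // Omega_defect_gt0.
apply: le_trans (taylor_calculus_le1 gx).
have e := angle_tuple_eigen z z ord_max c01.
apply: cabs_eigen_le e; apply/negP => /eqP/matrixP/(_ ord_max 0).
rewrite !mxE /= => /eqP; rewrite (inj_eq (@complexI R)) oner_eq0.
by [].
Qed.

Lemma psi_defect_ge0 z : Omega gamma z -> 0 <= 1 - cabs (psi z) ^+ 2.
Proof. by move=> gz; rewrite subr_ge0 expr_le1 ?cabs_ge0 // cabs_psi_le1. Qed.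

(** Contractivity of psi(X) on the combination of the two eigenvectors
    with coefficients r and - s conj(k), where k = 1 - conj(psi(z)) psi(w); this
    choice of phase makes the cross term equal to - 2 c |k|^2 r s. *)
Lemma pick_angle z w c : 0 <= c < 1 -> Omega gamma z -> Omega gamma w ->
  c ^+ 2 * N z w ^+ 2 < (1 - g z ^+ 2) * (1 - g w ^+ 2) ->
  c ^+ 2 * cabs (1 - Num.conj (psi z) * psi w) ^+ 2 <=
  (1 - cabs (psi z) ^+ 2) * (1 - cabs (psi w) ^+ 2).
Proof.
move=> c01 gz gw cN; have gx := angle_tuple_Ggamma c01 gz gw cN.
have X1 := taylor_calculus_le1 gx.
have XV h := eigen_cols_mul h (fun k => angle_tuple_eigen z w k c01).
move: (taylor_calculus _ _) X1 XV => X X1 XV.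
apply: binary_form_discr; rewrite ?psi_defect_ge0 ?sqr_ge0 // => r s.
set k := 1 - Num.conj (psi z) * psi w.
pose h : 'cV[C]_2 := \col_i pair_fun r%:C%C (- (s%:C%C * Num.conj k)) i.
have : l2norm (X *m (angle_basis c *m h)) <= l2norm (angle_basis c *m h).
  apply: le_trans (opnorm_mul _ _) _; apply: ler_piMl => //; exact: l2norm_ge0.
rewrite -ler_sqr ?nnegrE ?l2norm_ge0 // XV !l2norm_sqr !rdot_angle_basis //.
by rewrite !mxE ?pair_fun0 ?pair_fun1 -subr_ge0 pick_form_restriction.
Qed.

(** The constraint on the angle c in pick_angle allows every c below
      sqrt((1 - ||gamma(z)||^2) (1 - ||gamma(w)||^2)) / ||I - gamma(z)^* gamma(w)||,
    a quotient which is at most 1 because ||I - G^* H|| >= 1 - ||G|| ||H||. That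
    lower bound fails when gamma has no columns, hence the hypothesis on q. *)
Theorem schwarz_pick z w : (0 < q)%N -> Omega gamma z -> Omega gamma w ->
  cabs (1 - Num.conj (psi z) * psi w) ^+ 2 *
    ((1 - g z ^+ 2) * (1 - g w ^+ 2)) <=
  (1 - cabs (psi z) ^+ 2) * (1 - cabs (psi w) ^+ 2) * N z w ^+ 2.
Proof.
move=> q0 gz gw.
have P0 := Omega_defect_gt0 gz; have Q0 := Omega_defect_gt0 gw.
have Nge : 1 <= N z w + g z * g w.
  apply: le_trans (opnorm1_ge1 q0) _.
  rewrite -[X in opnorm X](subrK (adjmx (evalpt gamma z) *m evalpt gamma w)).
  apply: le_trans (opnormD _ _) _; rewrite lerD2l.
  apply: le_trans (opnormM _ _) _; rewrite ler_wpM2r ?opnorm_ge0 //.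
  exact: opnorm_adj_le.
have g0 : 0 <= g z by exact: opnorm_ge0.
have h0 : 0 <= g w by exact: opnorm_ge0.
have pick := fun c c01 => @pick_angle z w c c01 gz gw.
have Y0 : 0 <= (1 - cabs (psi z) ^+ 2) * (1 - cabs (psi w) ^+ 2).
  by rewrite mulr_ge0 ?psi_defect_ge0.
move: gz gw; rewrite /Omega /= -/(g z) -/(g w) => g1 h1.
move: (N z w) (g z) (g w) Nge g0 h0 pick P0 Q0 g1 h1 => n a b nab a0 b0 pick P0 Q0 a1 b1.
have n0 : 0 < n by nra.
pose S := (1 - a ^+ 2) * (1 - b ^+ 2) / n ^+ 2.
have SE : S * n ^+ 2 = (1 - a ^+ 2) * (1 - b ^+ 2).
  by rewrite mulfVK // expf_neq0 // gt_eqF.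
have n2 : 0 < n ^+ 2 by rewrite exprn_gt0.
have S0 : 0 < S by rewrite !(mulr_gt0, invr_gt0).
have S1 : S <= 1.
  rewrite ler_pdivrMr // mul1r.
  have h : 1 - a * b <= n by lra.
  have : (1 - a * b) ^+ 2 <= n ^+ 2 by rewrite ler_sqr ?nnegrE //; nra.
  have := sqr_ge0 (a - b); nra.
rewrite -SE mulrA ler_pM2r //; apply: le_of_le_sqr_scale => //.
  by rewrite mulr_ge0 ?sqr_ge0 // ltW.
move=> t /andP[t0 t1].
have c2 : (t * Num.sqrt S) ^+ 2 = t ^+ 2 * S by rewrite exprMn sqr_sqrtr // ltW.
have sS0 : 0 <= Num.sqrt S by exact: sqrtr_ge0.
have sS1 : Num.sqrt S <= 1 by rewrite -sqrtr1 ler_wsqrtr.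
rewrite [_ * S]mulrC mulrA -c2; apply: pick.
  by rewrite mulr_ge0 ?(ltW t0) //=; apply: le_lt_trans t1; rewrite ler_piMr // ltW.
rewrite c2 -mulrA SE -subr_gt0 -{1}[_ * (1 - b ^+ 2)]mul1r -mulrBl mulr_gt0 ?mulr_gt0 //.
by rewrite subr_gt0 expr_lt1 // ltW.
Qed.

End SchwarzPick.

(** * Approach to the boundary *)

Lemma cvg_meval (K : numFieldType) d (T : Type) (F : set_system T)
    (FF : Filter F) (P : mpoly.mpoly d K) (f : T -> 'I_d -> K^o)
    (a : 'I_d -> K^o) :
  (forall i, f t i @[t --> F] --> a i) ->
  (mpoly.meval (f t) P : K^o) @[t --> F] --> (mpoly.meval a P : K^o).
Proof.
move=> fa; rewrite mpoly.mevalE; under eq_fun do rewrite mpoly.mevalE.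
apply: (@cvg_big K^o _ +%R) => [x|m _]; first exact: add_continuous.
apply: (@cvgM K^o); first exact: cvg_cst.
apply: (@cvg_big K^o _ *%R) => [x|i _]; first exact: mul_continuous.
elim: (mpoly.fun_of_multinom m i) => [|k IH].
  by under eq_fun do rewrite expr0; rewrite expr0; exact: cvg_cst.
under eq_fun do rewrite exprS; rewrite exprS; exact: (@cvgM K^o).
Qed.

Section BoundaryLimit.
Context {R : realType} {d p q : nat}.
Local Notation C := R[i].
Variable gamma : 'M[mpoly.mpoly d C]_(p, q).

Lemma evalpt_near (tau : 'rV[C^o]_d) (e : R) : 0 < e ->
  \forall w \near tau, opnorm (evalpt gamma w - evalpt gamma tau) < e.
Proof.
move=> e0; pose e' := e / (p * q).+1%:R.
have e'0 : 0 < e' by rewrite divr_gt0.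
have FF : Filter (nbhs tau) by exact: nbhs_filter.
pose near_ij (ij : 'I_p * 'I_q) := [set w : 'rV[C^o]_d |
  cabs (evalpt gamma w ij.1 ij.2 - evalpt gamma tau ij.1 ij.2) < e'].
have near_entries : nbhs tau [set w | forall ij, near_ij ij w].
  apply: (@filter_forall _ _ near_ij _ FF) => -[i j].
  have e'C : (0 : C) < e'%:C%C by rewrite ltcR.
  have coords k : (w 0 k : C^o) @[w --> tau] --> (tau 0 k : C^o).
    exact: coord_continuous.
  have /(@cvgrPdist_lt C C^o)/(_ _ e'C) := @cvg_meval C d _ _ FF (gamma i j) _ _ coords.
  apply: filterS => w; rewrite distrC /near_ij /= !mxE.
  by rewrite -ltcR -cabs_norm.
apply: filterS near_entries => w h.
apply: (le_lt_trans (opnorm_entries _)).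
apply: (@le_lt_trans _ _ (\sum_(j < q) \sum_(i < p) e')).
  by apply: ler_sum => j _; apply: ler_sum => i _; have := h (i, j); rewrite /near_ij /= !mxE => /ltW.
rewrite !sumr_const !card_ord -mulrnA -mulr_natr /e' mulrAC ltr_pdivrMr //.
by rewrite ltr_pM2l // ltr_nat ltnS.
Qed.

Lemma limf_einf_within_lt (T : topologicalType) (f : T -> \bar R) (D : set T)
    (a : T) (l : R) (e : R) (U : set T) :
  (limf_einf f (within D (nbhs a)) <= l%:E)%E -> 0 < e -> nbhs a U ->
  exists w, [/\ D w, U w & (f w < (l + e)%:E)%E].
Proof.
move=> fl e0 aU.
have : (ereal_inf (f @` (U `&` D)) < (l + e)%:E)%E.
  apply: (@le_lt_trans _ _ l%:E); last by rewrite lte_fin ltrDl.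
  apply: le_trans fl; rewrite limf_einfE; apply: ereal_sup_ubound.
  exists (U `&` D) => //; rewrite /within /=.
  by apply: filterS aU => x Ux Dx.
by move=> /ereal_inf_lt[_ [w [Uw Dw] <-] fw]; exists w.
Qed.

(** Along the filter generated by the sets of points of D close to a where f is
    almost at most l, the values of psi stay in a compact square of R^2, hence
    cluster at some omega. *)
Lemma unit_disc_cluster (T : topologicalType) (a : T) (D : set T) (f : T -> R) (l : R)
    (psi : T -> C) :
  (forall w, D w -> cabs (psi w) <= 1) ->
  (limf_einf (EFin \o f) (within D (nbhs a)) <= l%:E)%E ->
  exists omega, forall e U, 0 < e -> nbhs a U ->
    exists w, [/\ D w, U w, f w < l + e & cabs (psi w - omega) < e].
Proof.
move=> psi1 fl.
pose S (i : set T * R) := [set w | [/\ D w, i.1 w & f w < l + i.2]].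
pose I := [set i : set T * R | nbhs a i.1 /\ 0 < i.2].
pose F := filter_from I S.
have FF : ProperFilter F.
  apply: filter_from_proper; last first.
    move=> [U e] [/= aU e0].
    have [w [Dw Uw fw]] := limf_einf_within_lt fl e0 aU.
    by exists w; split => //=; rewrite -lte_fin.
  apply: filter_from_filter; first by exists (setT, 1); split => /=; [exact: filterT|exact: ltr01].
  move=> [U e] [V e'] [/= aU e0] [/= aV e0'].
  exists (U `&` V, Num.min e e'); first by split => /=; [exact: filterI|rewrite lt_min e0].
  move=> w [Dw [Uw Vw] /= fw]; split; split => //=.
    by apply: (lt_le_trans fw); rewrite lerD2l ge_min lexx.
  by apply: (lt_le_trans fw); rewrite lerD2l ge_min lexx orbT.
pose g w := (Re (psi w), Im (psi w)) : R * R.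
have Kc : compact (`[(-1 : R), 1] `*` `[(-1 : R), 1]).
  by apply: compact_setX; exact: segment_compact.
have KF : (g @ F) (`[(-1 : R), 1] `*` `[(-1 : R), 1]).
  exists (setT, 1); first by split => /=; [exact: filterT|exact: ltr01].
  move=> w [/psi1 w1 _ _].
  have : Re (psi w) ^+ 2 + Im (psi w) ^+ 2 <= 1.
    by rewrite -cabs_sqr expr_le1 ?cabs_ge0.
  have unit_itv (x : R) : x ^+ 2 <= 1 -> x \in `[-1, 1].
    by rewrite in_itv /= -ler_norml -{1}(real_normK (num_real x)) expr_le1.
  have := sqr_ge0 (Re (psi w)); have := sqr_ge0 (Im (psi w)) => I0 R0 h.
  by split; apply: unit_itv; apply: le_trans h; rewrite ?lerDl ?lerDr.
have [[x y] [_ xy]] := Kc _ _ KF.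
exists (Complex x y) => e U e0 aU.
have FS : (g @ F) (g @` S (U, e)).
  by exists (U, e) => // w Sw; exists w.
have e2 : 0 < e / 2 by rewrite divr_gt0.
have [_ [[w [Dw Uw fw] <-] [/= Rw Iw]]] := xy _ _ FS (nbhsx_ballx (x, y) _ e2).
exists w; split => //.
apply: le_lt_trans (_ : `|x - Re (psi w)| + `|y - Im (psi w)| < e).
  rewrite -ler_sqr ?nnegrE ?cabs_ge0 ?addr_ge0 // cabs_sqr !re_im /=.
  rewrite [leRHS]sqrrD !real_normK ?num_real //.
  rewrite -(sqrrN (x - _)) -(sqrrN (y - _)) !opprB.
  by rewrite addrAC lerDl mulrn_wge0 // mulr_ge0.
by rewrite [ltRHS](splitr e) ltrD.
Qed.

End BoundaryLimit.

(** * The boundary inequality *)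

Lemma boundary_open_notin (T : topologicalType) (U : set T) (x : T) :
  open U -> (closure U `\` interior U) x -> ~ U x.
Proof. by move=> /interior_id Uo [_]; rewrite Uo. Qed.

Lemma opnorm_adj_diff_le (R : realType) p q (A B H : 'M[R[i]]_(p, q)) :
  opnorm (1%:M - adjmx A *m H) <=
  opnorm (1%:M - adjmx B *m H) + opnorm (A - B) * opnorm H.
Proof.
have -> : 1%:M - adjmx A *m H = (1%:M - adjmx B *m H) + adjmx (B - A) *m H.
  by rewrite adjmxB mulmxBl addrA subrK.
apply: le_trans (opnormD _ _) _; rewrite lerD2l.
apply: le_trans (opnormM _ _) _; rewrite ler_wpM2r ?opnorm_ge0 //.
by apply: le_trans (opnorm_adj_le _) _; rewrite -opprB opnormN.
Qed.

Theorem corollary6p1 (R : realType) (d p q : nat)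
  (gamma : 'M[mpoly.mpoly d R[i]]_(p, q))
  (psi : 'rV[R[i]^o]_d -> R[i]) (tau : 'rV[R[i]^o]_d) (alpha : R)
  (Omega_domain : is_domain (Omega gamma))
  (psi_holo : holomorphic_on (Omega gamma) psi)
  (psi_norm : Hinfnorm gamma psi = 1%:E)
  (tau_bd : boundary (Omega gamma) tau)
  (liminf_alpha :
     limf_einf
       (fun z : 'rV[R[i]^o]_d => ((1 - cabs (psi z) ^+ 2) /
                  (1 - opnorm (evalpt gamma z) ^+ 2))%:E)
       (within (Omega gamma) (nbhs tau)) = alpha%:E) :
  exists omega : R[i], cabs omega = 1 /\
    forall z, Omega gamma z ->
      cabs (psi z - omega) ^+ 2 / (1 - cabs (psi z) ^+ 2) <=
      alpha * (opnorm (1%:M - adjmx (evalpt gamma tau) *m evalpt gamma z) ^+ 2 /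
               (1 - opnorm (evalpt gamma z) ^+ 2)).
Proof.
case: Omega_domain => Omega_open _ _.
have norm1 : (Hinfnorm gamma psi <= 1%:E)%E by rewrite psi_norm.
have gtau : 1 <= opnorm (evalpt gamma tau).
  by rewrite leNgt; apply/negP; exact: boundary_open_notin tau_bd.
(* Without columns gamma would have norm 0 everywhere. *)
have q0 : (0 < q)%N.
  rewrite lt0n; apply: contraTneq gtau => q0; rewrite -ltNge.
  apply: le_lt_trans (opnorm_entries _) _; rewrite big1 ?ltr01 // => -[j jq] _.
  by exfalso; move: jq; rewrite q0.
have psi1 w : Omega gamma w -> cabs (psi w) <= 1 := @cabs_psi_le1 _ _ _ _ _ _ norm1 w.
pose f w := (1 - cabs (psi w) ^+ 2) / (1 - opnorm (evalpt gamma w) ^+ 2).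
have f_lim : (limf_einf (EFin \o f) (within (Omega gamma) (nbhs tau)) <= alpha%:E)%E.
  by rewrite -liminf_alpha.
have [omega approx0] := unit_disc_cluster psi1 f_lim.
have approx e : 0 < e -> exists w, [/\ Omega gamma w,
    opnorm (evalpt gamma w - evalpt gamma tau) < e,
    1 - cabs (psi w) ^+ 2 <= (alpha + e) * (1 - opnorm (evalpt gamma w) ^+ 2) &
    cabs (psi w - omega) < e].
  move=> e0; have [w [gw tw fw pw]] := approx0 _ _ e0 (evalpt_near gamma tau e0).
  exists w; split => //.
  by move/ltW: fw; rewrite ler_pdivrMr //; exact: Omega_defect_gt0.
have alpha0 : 0 <= alpha.
  apply/ler_addgt0Pr => e e0; have [w [gw _ h _]] := approx _ e0.
  have P0 := Omega_defect_gt0 gw.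
  by rewrite -(pmulr_lge0 _ P0); apply: le_trans h; exact: psi_defect_ge0 norm1 _ gw.
have omega1 : cabs omega = 1.
  apply/eqP; rewrite eq_le; apply/andP; split.
    apply: (@le_of_le_add_eps _ _ _ 1) => // e /andP[e0 _].
    have [w [gw _ _ pw]] := approx _ e0.
    have := cabsD (psi w) (omega - psi w); rewrite addrC subrK -(cabsN (omega - _)) opprB.
    move=> tri; rewrite mulr1; apply: le_trans tri _.
    by rewrite lerD ?psi1 ?ltW.
  apply: (@le_of_le_add_eps _ _ _ (2 * alpha + 3)) => [|e /andP[e0 e1]]; first lra.
  have [w [gw tw h pw]] := approx _ e0.
  have tri := cabsD omega (psi w - omega).
  rewrite addrC subrK in tri.
  have trig := opnormD (evalpt gamma w) (evalpt gamma tau - evalpt gamma w).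
  rewrite addrC subrK -(opnormN (_ - _)) opprB in trig.
  apply: (boundary_modulus_error _ gtau trig _ tri alpha0 _ tw pw h).
  - by rewrite opnorm_ge0; exact: gw.
  - by rewrite cabs_ge0 psi1.
  - by rewrite e0.
exists omega; split => // z gz.
have S0 := Omega_defect_gt0 gz.
have T0 := psi_defect_ge0 norm1 gz.
have z1 := psi1 _ gz.
have dist : cabs (psi z - omega) = cabs (1 - Num.conj omega * psi z).
  have oo : Num.conj omega * omega = 1.
    have := cabs_sqr omega; rewrite omega1 expr1n => h.
    apply/eqP; rewrite eq_complex; apply/andP; split; apply/eqP; rewrite !re_im /=.
      by rewrite h; ring.
    by ring.
  rewrite -[LHS]mul1r -omega1 -cabs_conj -cabsM mulrBr oo -cabsN opprB.
  by [].
set N := opnorm (1%:M - _).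
have N0 : 0 <= N by exact: opnorm_ge0.
set S := 1 - opnorm _ ^+ 2 in S0 *.
set T := 1 - cabs (psi z) ^+ 2 in T0 *.
suff key : cabs (psi z - omega) ^+ 2 * S <= alpha * T * N ^+ 2.
  (* When |psi(z)| = 1 the quotient on the left is 0 by convention. *)
  have [->|Tn0] := eqVneq T 0.
    by rewrite invr0 mulr0 mulr_ge0 // divr_ge0 ?sqr_ge0 // ltW.
  have Tgt0 : 0 < T by rewrite lt0r Tn0.
  rewrite ler_pdivrMr // mulrA -mulrAC ler_pdivlMr //.
  by apply: le_trans key _; rewrite mulrAC.
set X := cabs (psi z - omega) in dist *.
apply: (@le_of_le_add_eps _ _ _ (T * (N + 1) ^+ 2 + alpha * T * (2 * N + 1) + 5 * S)).
  apply: addr_ge0; last by rewrite mulr_ge0 ?ler0n ?(ltW S0).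
  apply: addr_ge0; first by rewrite mulr_ge0 ?sqr_ge0.
  by rewrite mulr_ge0 ?(mulr_ge0 alpha0) // addr_ge0 ?ler01 // mulr_ge0 ?ler0n.
move=> e /andP[e0 e1]; have [w [gw tw h pw]] := approx _ e0.
have P0 := Omega_defect_gt0 gw.
have Nw := opnorm_adj_diff_le (evalpt gamma w) (evalpt gamma tau) (evalpt gamma z).
have pick := schwarz_pick norm1 q0 gw gz.
have w1 := psi1 _ gw.
have tri : X <= cabs (1 - Num.conj (psi w) * psi z) + e.
  rewrite dist.
  have -> : 1 - Num.conj omega * psi z =
      (1 - Num.conj (psi w) * psi z) + Num.conj (psi w - omega) * psi z.
    by rewrite rmorphB; ring.
  apply: le_trans (cabsD _ _) _; rewrite lerD2l cabsM cabs_conj.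
  have h1 := cabs_ge0 (psi w - omega).
  by apply: le_trans (ltW pw); rewrite ler_piMr.
have y2 : cabs (1 - Num.conj (psi w) * psi z) <= 2.
  apply: le_trans (cabsD _ _) _; rewrite cabsN cabsM cabs_conj cabs1.
  have h1 : cabs (psi w) * cabs (psi z) <= 1 by rewrite mulr_ile1 ?cabs_ge0.
  by apply: lerD => //.
have Nwe : opnorm (1%:M - adjmx (evalpt gamma w) *m evalpt gamma z) <= N + e.
  apply: le_trans Nw _; rewrite lerD2l.
  have g1 : opnorm (evalpt gamma z) < 1 := gz.
  exact: le_trans (ler_piMr (opnorm_ge0 _) (ltW g1)) (ltW tw).
apply: (julia_error (cabs_ge0 _) _ (ltW S0) T0 N0 (opnorm_ge0 _) P0 alpha0 _ tri Nwe h pick).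
  by rewrite cabs_ge0.
by rewrite e0.
Qed.
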